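(* Suppose the weak unit distance conjecture holds: for every $\varepsilon>0$ there is $C_\varepsilon>0$ such that every finite set $P\subset\mathbb{R}^2$ determines at most $C_\varepsilon|P|^{1+\varepsilon}$ pairs of points at Euclidean distance $1$. Then the weak pinned distance conjecture holds: for every $\varepsilon>0$ there is $C'_\varepsilon>0$ such that every finite set $P\subset\mathbb{R}^2$ contains a point $q$ for which the set $\{\|q-y\|:y\in P\}$ of Euclidean distances from $q$ to the points of $P$ has at least $C'_\varepsilon|P|^{1-\varepsilon}$ elements.
   Context: $\|\cdot\|$ denotes the Euclidean norm on $\mathbb{R}^2$. *)

(* Defs.v *)
From mathcomp Require Import all_boot all_order all_algebra.
From mathcomp Require Export finmap.
From mathcomp Require Export reals exp.

Set Implicit Arguments.
Unset Strict Implicit.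
Unset Printing Implicit Defensive.

Import Order.TTheory GRing.Theory Num.Theory.
Local Open Scope ring_scope.
Local Open Scope fset_scope.

(* The norm `|v| that MathComp-Analysis puts on 'rV[R]_2 is the sup norm, hence
   an explicit Euclidean norm. *)
Definition enorm (R : realType) (v : 'rV[R]_2) : R :=
  Num.sqrt (\sum_(i < 2) v 0 i ^+ 2).

(* Pairs are unordered: each is the two-element set of its points. *)
Definition unit_pairs (R : realType) (P : {fset 'rV[R]_2}) :
    {fset {fset 'rV[R]_2}} :=
  [fset [fset p.1; p.2] | p in P `*` P & enorm (p.1 - p.2) == 1].

Definition pinned_distances (R : realType) (q : 'rV[R]_2)
    (P : {fset 'rV[R]_2}) : {fset R} :=
  [fset enorm (q - y) | y in P].

Definition weak_unit_distance_conjecture (R : realType) : Prop :=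
  forall eps : R, 0 < eps ->
  exists2 C : R, 0 < C &
  forall P : {fset 'rV[R]_2},
    #|` unit_pairs P|%:R <= C * (#|` P|%:R `^ (1 + eps)).

(* Only nonempty P: the empty set contains no point q. *)
Definition weak_pinned_distance_conjecture (R : realType) : Prop :=
  forall eps : R, 0 < eps ->
  exists2 C : R, 0 < C &
  forall P : {fset 'rV[R]_2}, P != fset0 ->
  exists2 q : 'rV[R]_2, q \in P &
    C * (#|` P|%:R `^ (1 - eps)) <= #|` pinned_distances q P|%:R.

(* Main.v *)
(** Call x in P incident to d if some y in P has |x - y| = d, and let P_d be
    the set of points incident to d.  Both ends of a pair at distance d lie in
    P_d, so the unit distance conjecture, applied to P_d scaled by 1/d, bounds
    the number of such pairs by O(|P_d| n^eps), where n = |P|.  Summing over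
    all distances d gives n^2 = O(n^eps \sum_d |P_d|), and \sum_d |P_d| is also
    the sum over x in P of the number of distances pinned at x; hence some x
    pins at least c n^(1 - eps) distances. *)
Require Import Defs.
From mathcomp Require Import all_boot all_order all_algebra.
From mathcomp Require Import reals finmap.

Set Implicit Arguments.
Unset Strict Implicit.
Unset Printing Implicit Defensive.

Import Order.TTheory GRing.Theory Num.Theory.
Local Open Scope ring_scope.
Local Open Scope fset_scope.

Section EuclideanNorm.
Variable R : realType.
Implicit Types (u v : 'rV[R]_2) (a : R).

Lemma enormZ a v : enorm (a *: v) = `|a| * enorm v.
Proof.
rewrite /enorm -sqrtr_sqr -sqrtrM ?sqr_ge0// mulr_sumr.
by congr Num.sqrt; apply: eq_bigr => i _; rewrite mxE exprMn.
Qed.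

Lemma enormB u v : enorm (u - v) = enorm (v - u).
Proof. by rewrite -opprB -scaleN1r enormZ normrN1 mul1r. Qed.

Lemma enorm_ge0 v : 0 <= enorm v.
Proof. exact: sqrtr_ge0. Qed.

Lemma enorm_eq0 v : (enorm v == 0) = (v == 0).
Proof.
apply/idP/eqP => [|->]; last by rewrite -(scale0r 0) enormZ normr0 mul0r.
rewrite /enorm sqrtr_eq0 => le0; apply/rowP => i; rewrite mxE.
have /eqP : \sum_(i < 2) v 0 i ^+ 2 = 0.
  by apply/eqP; rewrite eq_le le0 sumr_ge0// => j _; exact: sqr_ge0.
rewrite psumr_eq0 => [/allP/(_ i (mem_index_enum i))|j _]; last exact: sqr_ge0.
by rewrite sqrf_eq0 => /eqP.
Qed.

End EuclideanNorm.

Lemma leq_card_fibers (K L : choiceType) (h : K -> L) (A : {fset K}) (k : nat) :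
  (forall a, a \in A -> (#|` [fset x in A | h x == h a]| <= k)%N) ->
  (#|` A| <= k * #|` [fset h x | x in A]|)%N.
Proof.
move=> fib; rewrite -(sum1_size A) (partition_big_imfset _ h)/=.
rewrite -(sum1_size [fset h x | x in A]) big_distrr/=.
rewrite big_seq [leqRHS]big_seq; apply: leq_sum => b /imfsetP[a/= aA ->].
by rewrite muln1 big_fset_condE/= sum1_size; exact: fib.
Qed.

Section Distances.
Variable R : realType.
Implicit Types (P : {fset 'rV[R]_2}) (d : R).

(** Pairs are ordered and the diagonal is kept at [d = 0], so that these sets partition all of [P] ×
    [P]. *)
Definition pairs_at d P : {fset 'rV[R]_2 * 'rV[R]_2} :=
  [fset p in P `*` P | enorm (p.1 - p.2) == d].

Definition incident_points d P : {fset 'rV[R]_2} :=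
  [fset x in P | d \in pinned_distances x P].

Definition distances P : {fset R} :=
  [fset enorm (p.1 - p.2) | p in P `*` P].

(** Forgetting the order is at most two-to-one: only [(a, b)] and [(b, a)] yield the set of [a] and
    [b]. *)
Lemma card_pairs_at1 P : (#|` pairs_at 1 P| <= 2 * #|` unit_pairs P|)%N.
Proof.
have -> : unit_pairs P = [fset [fset p.1; p.2] | p in pairs_at 1 P].
  apply/fsetP => u; apply/imfsetP/imfsetP => -[p/= pP ->]; exists p => //;
    by move: pP; rewrite !inE.
apply: leq_card_fibers => -[a b] _ /=.
have /fsubset_leq_card/leq_trans -> // : [fset p in pairs_at 1 P |
    [fset p.1; p.2] == [fset a; b]] `<=` [fset (a, b); (b, a)].
  (* Reading the equality of the two sets in both directions rules out [(a, a)] and [(b, b)] unless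
     [a = b]. *)
  apply/fsubsetP => -[x y]; rewrite !inE/= => /andP[_ /eqP E].
  have := fset21 x y; have := fset22 x y; rewrite E !inE.
  have := fset21 a b; have := fset22 a b; rewrite -E !inE !xpair_eqE.
  by do 4![case/orP=> /eqP ?]; subst; rewrite !eqxx ?orbT.
by rewrite cardfs2; case: eqP.
Qed.

(** Only diagonal pairs occur here; this covers the one distance that cannot be rescaled to 1. *)
Lemma card_pairs_at0 P : (#|` pairs_at 0 P| <= #|` P|)%N.
Proof.
apply: (@leq_trans #|` [fset (x, x) | x in P]|); last exact: leq_imfset_card.
apply/fsubset_leq_card/fsubsetP => -[x y]; rewrite !inE/=.
by rewrite enorm_eq0 subr_eq0 => /andP[/andP[xP _] /eqP <-]; exact: in_imfset.
Qed.

(** Scaling both ends by [d^-1] is injective on pairs and turns distance [d] into 1; both ends are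
    incident to [d], by symmetry of the norm. *)
Lemma card_pairs_at_scale P d : 0 < d ->
  (#|` pairs_at d P|
     <= #|` pairs_at 1 [fset d^-1 *: x | x in incident_points d P]|)%N.
Proof.
move=> d0; pose f (p : 'rV[R]_2 * 'rV[R]_2) := (d^-1 *: p.1, d^-1 *: p.2).
have f_inj : injective f.
  have s_inj : injective ( *:%R d^-1 : 'rV[R]_2 -> _).
    by apply: scalerI; rewrite invr_eq0 gt_eqF.
  by move=> [x y] [z t] [/s_inj -> /s_inj ->].
have <- : #|` [fset f p | p in pairs_at d P]| = #|` pairs_at d P|.
  exact: card_imfset.
apply/fsubset_leq_card/fsubsetP => _ /imfsetP[[x y]/= + ->].
rewrite !inE/= -scalerBr enormZ => /andP[/andP[xP yP] /eqP dxy].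
rewrite dxy ger0_norm ?invr_ge0 ?ltW// mulVf ?lt0r_neq0// eqxx andbT.
apply/andP; split; apply/imfsetP.
  by exists x => //; rewrite !inE/= xP; apply/imfsetP; exists y.
by exists y => //; rewrite !inE/= yP; apply/imfsetP; exists x; rewrite // enormB.
Qed.

Lemma sum_card_pairs_at P :
  (\sum_(d <- distances P) #|` pairs_at d P| = #|` P| * #|` P|)%N.
Proof.
transitivity #|` P `*` P|.
  rewrite -[RHS]sum1_size (partition_big_imfset _ (fun p => enorm (p.1 - p.2)))/=.
  by apply: eq_bigr => d _; rewrite big_fset_condE/= sum1_size.
by rewrite (perm_size (enum_imfset2 _ _)) ?size_allpairs// => -[? ?] [? ?] _ _ /= [-> ->].
Qed.

(** Double counting of the pairs [(x, d)] such that [x] pins [d]. *)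
Lemma sum_card_incident_points P :
  (\sum_(d <- distances P) #|` incident_points d P|
     = \sum_(x <- P) #|` pinned_distances x P|)%N.
Proof.
under eq_bigr do rewrite -sum1_size -big_fset_condE/= big_mkcond/=.
rewrite exchange_big/= [LHS]big_seq [RHS]big_seq; apply: eq_bigr => x xP.
rewrite -big_mkcond big_fset_condE/= sum1_size; congr #|` _|.
(* Restricting to [distances P] loses nothing, since every distance pinned at a point of [P] lies
   there. *)
apply/fsetP => d; rewrite !inE/= andb_idl// => /imfsetP[y/= yP ->].
by apply/imfsetP; exists (x, y) => //=; rewrite !inE xP.
Qed.

End Distances.

Theorem theorem4p8 (R : realType) :
  weak_unit_distance_conjecture R -> weak_pinned_distance_conjecture R.
Proof.
move=> unit_conj eps eps0; have [C C0 unit_le] := unit_conj _ eps0.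
(* The 1 serves the distance 0; in [2 * C] the factor 2 accounts for the two orders of a pair. *)
pose K := Num.max 1 (2 * C).
have K0 : 0 < K by rewrite lt_max ltr01.
exists K^-1; first by rewrite invr_gt0.
move=> P PN0; set n : R := #|` P|%:R.
have n1 : 1 <= n by rewrite ler1n cardfs_gt0.
have n0 : 0 < n := lt_le_trans ltr01 n1.
have neps1 : 1 <= n `^ eps by rewrite -(powRr0 n) ler_powR// ltW.
have pairs_le d : d \in distances P ->
    #|` pairs_at d P|%:R <= K * n `^ eps * #|` incident_points d P|%:R.
  case/imfsetP => -[x y]/= _ ->{d}.
  (* At distance 0 every point is incident to itself, so the trivial bound [n] suffices. *)
  have := enorm_ge0 (x - y); rewrite le_eqVlt => /orP[/eqP <-|].
    have -> : incident_points 0 P = P.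
      apply/fsetP => z; rewrite !inE/= andb_idr// => zP.
      by apply/imfsetP; exists z; rewrite // subrr; apply/esym/eqP; rewrite enorm_eq0.
    apply: le_trans (_ : n <= _); first by rewrite ler_nat card_pairs_at0.
    by rewrite ler_peMl ?(ltW n0)// mulr_ege1// le_max lexx.
  move: (enorm _) => d d0; set m : R := #|` incident_points d P|%:R.
  have mn : m <= n by rewrite ler_nat; apply/fsubset_leq_card/fset_sub.
  set Q := [fset d^-1 *: x | x in incident_points d P].
  have Qm : #|` Q|%:R <= m by rewrite ler_nat leq_imfset_card.
  apply: le_trans (_ : 2 * (C * m `^ (1 + eps)) <= _).
    apply: le_trans (_ : 2 * (#|` unit_pairs Q|%:R) <= _).
      rewrite -natrM ler_nat.
      exact: leq_trans (card_pairs_at_scale _ d0) (card_pairs_at1 _).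
    rewrite ler_pM2l// (le_trans (unit_le Q))// ler_pM2l//.
    by rewrite ge0_ler_powR ?nnegrE ?ler0n// addr_ge0// ltW.
  have m0 : 0 <= m by [].
  rewrite powRD ?(gt_eqF (addr_gt0 ltr01 eps0))// powRr1// [m * _]mulrC !mulrA.
  rewrite ler_wpM2r// ler_pM ?powR_ge0 ?mulr_ge0 ?(ltW C0)//.
    by rewrite le_max lexx orbT.
  by rewrite ge0_ler_powR ?nnegrE ?(ltW eps0) ?(ltW n0).
have nn_le : n * n <= K * n `^ eps * \sum_(x <- P) #|` pinned_distances x P|%:R.
  rewrite -natrM -sum_card_pairs_at -natr_sum -sum_card_incident_points !natr_sum.
  by rewrite mulr_sumr big_seq [leRHS]big_seq ler_sum.
have [/hasP[q qP le_q]|/hasPn lt_P] := boolP (has (fun q =>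
    K^-1 * n `^ (1 - eps) <= #|` pinned_distances q P|%:R) P).
  by exists q.
suff : n * n < n * n by rewrite ltxx.
apply: le_lt_trans nn_le _.
have -> : n * n = K * n `^ eps * \sum_(x <- P) (K^-1 * n `^ (1 - eps)).
  rewrite big_const_seq count_predT iter_addr_0 -mulr_natr -/n mulrA mulrACA.
  rewrite mulfV ?lt0r_neq0// mul1r -powRD ?(lt0r_neq0 n0) ?implybT//.
  by rewrite (addrC eps) subrK powRr1 ?(ltW n0).
rewrite ltr_pM2l ?mulr_gt0 ?powR_gt0//.
(* The sum of strict inequalities is strict only because [P] has a point. *)
have [z zP] := fset0Pn _ PN0.
rewrite big_seq [ltRHS]big_seq; apply: ltr_sum => [|x /lt_P]; last by rewrite -ltNge.
by apply/hasP; exists z.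
Qed.
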